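(* Let $\mathrm{L}$ be a coatomic logic and let $\kappa$ be a cardinal with $1 < \kappa \leq |\mathrm{Var}\,\mathrm{L}|^{+}$. (a) If $\mathrm{L}$ enjoys the $\kappa$-ary simple parametrized local IL w.r.t. a family $\Psi$, then the following are equivalent: (1) $\mathrm{L}$ is semisimple; (2) $\mathrm{L}$ enjoys the parametrized local LEM (w.r.t. some family); (3) $\mathrm{L}$ enjoys the dual parametrized local IL (w.r.t. some family); (4) $\mathrm{L}$ enjoys the parametrized local LEM w.r.t. $\Psi$; (5) $\mathrm{L}$ enjoys the dual parametrized local IL w.r.t. $\Psi$. (b) If $\mathrm{L}$ enjoys the $\kappa$-ary simple local IL w.r.t. a family $\Psi$, then the following are equivalent: (1) $\mathrm{L}$ is semisimple; (2) $\mathrm{L}$ enjoys the local LEM (w.r.t. some family); (3) $\mathrm{L}$ enjoys the dual local IL (w.r.t. some family); (4) $\mathrm{L}$ enjoys the local LEM w.r.t. $\Psi$; (5) $\mathrm{L}$ enjoys the dual local IL w.r.t. $\Psi$. (The LEMs and dual ILs here are $\kappa$-ary.)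
   Context: A logic $\mathrm{L}$ is given by an infinite set of variables $\mathrm{Var}\,\mathrm{L}$, the absolutely free algebra of formulas over $\mathrm{Var}\,\mathrm{L}$ in some signature (with underlying set $\mathrm{Fm}\,\mathrm{L}$), and a relation $\Gamma \vdash_{\mathrm{L}} \varphi$ between sets of formulas and formulas which is reflexive ($\varphi \vdash_{\mathrm L} \varphi$), monotone, closed under cut (if $\Gamma \vdash_{\mathrm L} \varphi$ for all $\varphi\in\Phi$ and $\Phi \vdash_{\mathrm L} \psi$, then $\Gamma \vdash_{\mathrm L} \psi$) and structural (closed under substitutions, i.e. endomorphisms of the formula algebra). Finitarity is not assumed. $\Gamma \vdash_{\mathrm L} \Phi$ means $\Gamma \vdash_{\mathrm L} \varphi$ for all $\varphi \in \Phi$. A theory is a set of formulas closed under $\vdash_{\mathrm L}$; the trivial theory is $\mathrm{Fm}\,\mathrm{L}$; a theory is simple if it is maximal among non-trivial theories, and semisimple if it is an intersection of a (possibly empty) family of simple theories. $\mathrm L$ is semisimple if all its theories are semisimple, and coatomic if every non-trivial theory is included in a simple theory. Families: for each ordinal $0<\alpha<\kappa$, $\Psi_\alpha$ is a family of sets of formulas $I(\overline{p},\overline{q})$, where $\overline p$ is an $\alpha$-tuple of distinct variables and $\overline{q}$ is a tuple of further variables (parameters). $I(\overline\varphi,\overline\pi)$ denotes the result of substituting $\overline\varphi$ for $\overline p$ and $\overline \pi$ for $\overline q$. Below, $\overline\varphi$ ranges over $\alpha$-tuples of formulas and $\overline\pi$ over tuples of formulas of the appropriate length. $\mathrm L$ enjoys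 (all for every $0<\alpha<\kappa$): - the $\kappa$-ary simple parametrized local IL (inconsistency lemma) w.r.t. $\Psi$ if $\overline\varphi, I(\overline\varphi,\overline\pi) \vdash_{\mathrm L} \mathrm{Fm}\,\mathrm L$ for all $I\in\Psi_\alpha$, $\overline\varphi$, $\overline\pi$, and for each simple theory $T$ and each $\overline\varphi$: if $T,\overline\varphi\vdash_{\mathrm L}\mathrm{Fm}\,\mathrm L$, then $T\vdash_{\mathrm L} I(\overline\varphi,\overline\pi)$ for some $I\in\Psi_\alpha$ and some $\overline\pi$; - the $\kappa$-ary dual parametrized local IL w.r.t. $\Psi$ if for all $\Gamma$, $\overline\varphi$: $\Gamma\vdash_{\mathrm L}\overline\varphi$ if and only if $\Gamma, I(\overline\varphi,\overline\pi)\vdash_{\mathrm L}\mathrm{Fm}\,\mathrm L$ for each $I\in\Psi_\alpha$ and each $\overline\pi$; - the $\kappa$-ary parametrized local LEM (law of the excluded middle) w.r.t. $\Psi$ if $\overline\varphi, I(\overline\varphi,\overline\pi) \vdash_{\mathrm L} \mathrm{Fm}\,\mathrm L$ for all $I\in\Psi_\alpha$, $\overline\varphi$, $\overline\pi$, and moreover $\Gamma\vdash_{\mathrm L}\psi$ whenever $\Gamma,\overline\varphi\vdash_{\mathrm L}\psi$ and $\Gamma,I(\overline\varphi,\overline\pi)\vdash_{\mathrm L}\psi$ for each $I\in\Psi_\alpha$ and each $\overline\pi$. The word ''parametrized'' is dropped (simple local IL, dual local IL, local LEM) when all sets in the family are of the form $I(\overline p)$, i.e. there are no parameters $\overline q$.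 *)

(* Defs.v *)
From mathcomp Require Import all_boot.
From mathcomp Require Import boolp classical_sets functions cardinality wochoice.

Set Implicit Arguments.
Unset Strict Implicit.
Unset Printing Implicit Defensive.

Local Open Scope classical_set_scope.
Local Open Scope card_scope.

Record signature := Signature { op : Type; arity : op -> nat }.

Section Formulas.
Variables (V : Type) (S : signature).

Inductive fm := FVar (v : V) | FApp (o : op S) of (fm ^ arity o)%type.

Fixpoint fvars (f : fm) : set V :=
  match f with
  | FVar v => [set v]
  | FApp _ a => [set v | exists i, fvars (a i) v]
  end.

Definition endomorphism (h : fm -> fm) : Prop :=
  forall (o : op S) (a : (fm ^ arity o)%type),
    h (FApp a) = FApp [ffun i => h (a i)].

(* The unique endomorphism extending s : V -> fm. *)
Fixpoint fsubst (s : V -> fm) (f : fm) : fm :=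
  match f with
  | FVar v => s v
  | FApp _ a => FApp [ffun i => fsubst s (a i)]
  end.

Lemma fsubst_endomorphism (s : V -> fm) : endomorphism (fsubst s).
Proof. by []. Qed.

End Formulas.

Record logic := Logic {
  Var : Type;
  Var_infinite : infinite_set [set: Var];
  Sig : signature;
  entails : set (fm Var Sig) -> fm Var Sig -> Prop;
  entails_refl : forall phi, entails [set phi] phi;
  entails_mono : forall Gamma Delta phi,
    Gamma `<=` Delta -> entails Gamma phi -> entails Delta phi;
  entails_cut : forall Gamma Phi psi,
    (forall phi, Phi phi -> entails Gamma phi) ->
    entails Phi psi -> entails Gamma psi;
  entails_struct : forall h Gamma phi,
    endomorphism h -> entails Gamma phi -> entails (h @` Gamma) (h phi)
}.

Definition Fm (L : logic) : Type := fm (Var L) (Sig L).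

Section Theories.
Variable L : logic.
Implicit Types T Gamma Phi : set (Fm L).

Definition entails_set Gamma Phi : Prop :=
  forall phi, Phi phi -> entails Gamma phi.

Definition explosive Gamma : Prop := entails_set Gamma [set: Fm L].

Definition theory T : Prop := forall phi, entails T phi -> T phi.

Definition nontrivial_theory T : Prop := theory T /\ T <> [set: Fm L].

Definition simple_theory T : Prop :=
  nontrivial_theory T /\
  (forall T', nontrivial_theory T' -> T `<=` T' -> T' = T).

Definition semisimple_theory T : Prop :=
  exists F : set (set (Fm L)),
    (forall S, F S -> simple_theory S) /\ T = \bigcap_(S in F) S.

Definition semisimple : Prop := forall T, theory T -> semisimple_theory T.

Definition coatomic : Prop :=
  forall T, nontrivial_theory T -> exists2 S, simple_theory S & T `<=` S.

End Theories.

(* A cardinal is an initial ordinal, given as a well-ordered type (with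
   reflexive order [cardinal_le]) that does not inject into any of its proper
   initial segments. The ordinals alpha < kappa are then the elements a of kappa:
   a stands for the order type of [segment a]. *)
Record cardinal := Cardinal {
  cardinal_sort :> Type;
  cardinal_le : rel cardinal_sort;
  cardinal_wo : well_order cardinal_le;
  cardinal_initial : forall a : cardinal_sort,
    ~ ([set: cardinal_sort] #<= [set b | cardinal_le b a /\ b <> a])
}.

Definition segment (kappa : cardinal) (a : kappa) : Type :=
  {b : kappa | cardinal_le b a /\ b <> a}.

Definition ord_pos (kappa : cardinal) (a : kappa) : Prop :=
  exists b : kappa, cardinal_le b a /\ b <> a.

Definition smaller (A B : Type) : Prop :=
  [set: A] #<= [set: B] /\ ~ ([set: B] #<= [set: A]).

Definition successor_cardinal (A : Type) (mu : cardinal) : Prop :=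
  smaller A mu /\
  (forall nu : cardinal, smaller A nu -> [set: mu] #<= [set: nu]).

(* A set of formulas I(p, q): p is an A-indexed tuple of distinct variables and
   q a tuple (of any length) of distinct further variables, which together
   cover all variables occurring in I. *)
Record scheme (L : logic) (A : Type) := Scheme {
  main_var : A -> Var L;
  par_index : Type;
  par_var : par_index -> Var L;
  main_var_inj : injective main_var;
  par_var_inj : injective par_var;
  main_par_disj : forall i j, main_var i <> par_var j;
  body : set (Fm L);
  body_vars : forall f, body f ->
    fvars f `<=` range main_var `|` range par_var
}.

Section Instances.
Variables (L : logic) (A : Type) (I : scheme L A).

Definition scheme_subst (phi : A -> Fm L) (pi : par_index I -> Fm L)
    (v : Var L) : Fm L :=
  match pselect (exists i, main_var I i = v) with
  | left e => phi (projT1 (cid e))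
  | right _ =>
    match pselect (exists j, par_var (s := I) j = v) with
    | left e => pi (projT1 (cid e))
    | right _ => FVar _ v
    end
  end.

Definition instance (phi : A -> Fm L) (pi : par_index I -> Fm L) :
  set (Fm L) := fsubst (scheme_subst phi pi) @` body I.

End Instances.

(* The value of a family at the ordinal 0 is never used. *)
Definition scheme_family (L : logic) (kappa : cardinal) : Type :=
  forall a : kappa, set (scheme L (segment a)).

Section Principles.
Variables (L : logic) (kappa : cardinal).
Implicit Type Psi : scheme_family L kappa.

Definition parameter_free Psi : Prop :=
  forall (a : kappa) (I : scheme L (segment a)),
    ord_pos a -> Psi a I -> par_index I -> False.

Definition instances_inconsistent Psi : Prop :=
  forall (a : kappa) (I : scheme L (segment a))
         (phi : segment a -> Fm L) (pi : par_index I -> Fm L),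
    ord_pos a -> Psi a I -> explosive (range phi `|` instance phi pi).

Definition simple_param_local_IL Psi : Prop :=
  instances_inconsistent Psi /\
  (forall (a : kappa) (T : set (Fm L)) (phi : segment a -> Fm L),
    ord_pos a -> simple_theory T -> explosive (T `|` range phi) ->
    exists (I : scheme L (segment a)) (pi : par_index I -> Fm L),
      Psi a I /\ entails_set T (instance phi pi)).

Definition dual_param_local_IL Psi : Prop :=
  forall (a : kappa) (Gamma : set (Fm L)) (phi : segment a -> Fm L),
    ord_pos a ->
    (entails_set Gamma (range phi) <->
     forall (I : scheme L (segment a)) (pi : par_index I -> Fm L),
       Psi a I -> explosive (Gamma `|` instance phi pi)).

Definition param_local_LEM Psi : Prop :=
  instances_inconsistent Psi /\
  (forall (a : kappa) (Gamma : set (Fm L)) (phi : segment a -> Fm L)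
          (psi : Fm L),
    ord_pos a ->
    entails (Gamma `|` range phi) psi ->
    (forall (I : scheme L (segment a)) (pi : par_index I -> Fm L),
       Psi a I -> entails (Gamma `|` instance phi pi) psi) ->
    entails Gamma psi).

Definition simple_local_IL Psi : Prop :=
  parameter_free Psi /\ simple_param_local_IL Psi.

Definition dual_local_IL Psi : Prop :=
  parameter_free Psi /\ dual_param_local_IL Psi.

Definition local_LEM Psi : Prop :=
  parameter_free Psi /\ param_local_LEM Psi.

End Principles.

(* Main.v *)
Require Import Defs.
From mathcomp Require Import all_boot.
From mathcomp Require Import boolp classical_sets functions cardinality.

Local Open Scope classical_set_scope.
Local Open Scope card_scope.

(** In a semisimple logic, [Gamma |- psi] is tested on the simple theories [T]
    above [Gamma]. Such a [T] either contains a given tuple of formulas or is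
    inconsistent with it, and in the latter case the simple IL puts some
    [I(phi, pi)] inside [T]; so [psi] belongs to [T] as soon as it follows from
    [phi] and from each [I(phi, pi)], which is the LEM. The LEM with an
    arbitrary conclusion specializes to the dual IL. Given a dual IL and
    [T |-/- phi], some [T, I(phi, pi)] is consistent, and coatomicity extends it
    to a simple theory, which omits [phi]; hence [T] is an intersection of
    simple theories. *)

Lemma entails_in {L : logic} {Gamma : set (Fm L)} {phi} :
  Gamma phi -> entails Gamma phi.
Proof. by move=> h; apply: entails_mono (entails_refl phi) => _ ->. Qed.

Lemma theory_closure {L : logic} (Gamma : set (Fm L)) :
  theory [set phi | entails Gamma phi].
Proof. by move=> phi; apply: entails_cut. Qed.

Lemma entails_theory {L : logic} {Gamma T : set (Fm L)} {phi} :
  theory T -> Gamma `<=` T -> entails Gamma phi -> T phi.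
Proof. by move=> hT GT /(entails_mono GT) /hT. Qed.

Lemma explosive_mono {L : logic} {Gamma Delta : set (Fm L)} :
  Gamma `<=` Delta -> explosive Gamma -> explosive Delta.
Proof. by move=> GD h phi _; apply: (entails_mono GD); exact: h. Qed.

Lemma simple_theory_not_explosive {L : logic} {T : set (Fm L)} :
  simple_theory T -> ~ explosive T.
Proof.
by move=> [[hT Tnt] _] ex; apply: Tnt; apply/seteqP; split=> // f _;
   apply/hT/ex.
Qed.

Lemma coatomic_not_explosive {L : logic} {Gamma : set (Fm L)} :
  coatomic L -> ~ explosive Gamma -> exists2 S, simple_theory S & Gamma `<=` S.
Proof.
move=> coat Gne; have [|S simS GS] := coat [set f | entails Gamma f].
  split; first exact: theory_closure.
  by move=> /seteqP[_ ex]; apply: Gne => f /ex.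
by exists S => // f /entails_in /GS.
Qed.

(** The deductive closure of [T] together with [Phi] is a non-trivial theory above [T], so
    maximality makes it equal to [T]. *)
Lemma simple_theory_absorb {L : logic} {T Phi : set (Fm L)} :
  simple_theory T -> ~ explosive (T `|` Phi) -> Phi `<=` T.
Proof.
move=> [_ maxT] ne f Pf.
have <- : [set g | entails (T `|` Phi) g] = T.
  apply: maxT; last by move=> g Tg; apply: entails_in; left.
  split; first exact: theory_closure.
  by move=> /seteqP[_ ex]; apply: ne => g /ex.
by apply: entails_in; right.
Qed.

(** The closure of [Gamma] is an intersection of simple theories, and each of them contains
    [Gamma]. *)
Lemma semisimple_entails {L : logic} {Gamma : set (Fm L)} {phi} :
  semisimple L ->
  (forall T, simple_theory T -> Gamma `<=` T -> T phi) -> entails Gamma phi.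
Proof.
move=> ss h; have [F [Fsimple FE]] := ss _ (theory_closure Gamma).
suff : (\bigcap_(S in F) S) phi by rewrite -FE.
move=> S FS; apply: h; first exact: Fsimple.
move=> f /entails_in Gf.
by suff : (\bigcap_(S in F) S) f; [exact|rewrite -FE].
Qed.

Lemma semisimple_LEM {L : logic} {kappa : cardinal}
    {Psi : scheme_family L kappa} :
  simple_param_local_IL Psi -> semisimple L -> param_local_LEM Psi.
Proof.
move=> [incons sIL] ss; split=> // a Gamma phi psi apos Gphi GI.
apply: semisimple_entails => // T simT GT.
have [[thT _] _] := simT.
have [ex|ne] := pselect (explosive (T `|` range phi)).
  have [I [pi [PsiI TI]]] := sIL _ _ _ apos simT ex.
  apply: entails_theory (GI I pi PsiI) => // f [/GT//|/TI/thT//].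
apply: entails_theory Gphi => // f [/GT//|].
exact: simple_theory_absorb.
Qed.

Lemma LEM_dual_IL {L : logic} {kappa : cardinal}
    {Psi : scheme_family L kappa} :
  param_local_LEM Psi -> dual_param_local_IL Psi.
Proof.
move=> [incons lem] a Gamma phi apos; split.
  move=> Gphi I pi PsiI f _.
  apply: entails_cut (incons a I phi pi apos PsiI f Logic.I) => g [/Gphi|Ig].
    by apply: entails_mono => h; left.
  by apply: entails_in; right.
(* The LEM is used with a component [f] of the tuple as conclusion: it follows from the tuple
   trivially and from each instance by explosion. *)
move=> ex f phif; apply: (lem a Gamma phi f apos).
  by apply: entails_in; right.
by move=> I pi PsiI; apply: ex.
Qed.

(** This is the dual IL for [Gamma := range phi], which entails its own members. *)
Lemma dual_IL_instances_inconsistent {L : logic} {kappa : cardinal}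
    {Psi : scheme_family L kappa} :
  dual_param_local_IL Psi -> instances_inconsistent Psi.
Proof.
move=> dual a I phi pi apos; apply: (dual a (range phi) phi apos).1.
by move=> f; apply: entails_in.
Qed.

Lemma dual_IL_semisimple {L : logic} {kappa : cardinal}
    {Psi : scheme_family L kappa} {a : kappa} :
  coatomic L -> ord_pos a -> dual_param_local_IL Psi -> semisimple L.
Proof.
move=> coat apos dual T thT.
exists [set S | simple_theory S /\ T `<=` S]; split; first by move=> S [].
apply/seteqP; split=> [f Tf S [_ /(_ f)]|f hf]; first exact.
(* The constant tuple reduces a single formula to arity [a]; since [a] is positive, [f] does occur
   in its range. *)
pose phi := fun _ : segment a => f.
have [b lt_ba] := apos; pose i : segment a := exist _ b lt_ba.
suff ent : entails_set T (range phi) by apply/thT/ent; exists i.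
apply: (dual a T phi apos).2 => I pi PsiI.
apply: contrapT => /(coatomic_not_explosive coat)[S simS sub].
(* [S] lies above [T], so it contains [f] as well as the instance, and these are jointly
   inconsistent. *)
apply: (simple_theory_not_explosive simS).
apply: explosive_mono (dual_IL_instances_inconsistent dual a I phi pi apos PsiI).
move=> g [[j _ <-]|Ig]; last by apply: sub; right.
by apply: (hf S); split=> // h Th; apply: sub; left.
Qed.

Lemma ord_pos_exists {kappa : cardinal} :
  smaller unit kappa -> exists a : kappa, ord_pos a.
Proof.
move=> [/card_leP[f] le1].
have [|m [[_ minm] _]] := @cardinal_wo kappa predT.
  by exists (\val (f (to_setT tt))).
apply: contrapT => noa; apply: le1.
(* Any element other than the least one, [m], would be a positive ordinal; without one, [kappa] is a
   singleton. *)
have eqm b : b = m.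
  apply: contrapT => bm; apply: noa; exists b, m.
  by split; [exact: minm|exact: nesym].
suff -> : [set: kappa] = (fun=> m) @` [set: unit] by exact: card_image_le.
by apply/seteqP; split=> // b _; exists tt.
Qed.

Theorem theorem3p35 (L : logic) (kappa mu : cardinal)
    (hL : coatomic L)
    (hkappa1 : smaller unit kappa)
    (hmu : successor_cardinal (Var L) mu)
    (hkappa : [set: kappa] #<= [set: mu]) :
  (forall Psi : scheme_family L kappa, simple_param_local_IL Psi ->
     [<-> semisimple L;
          exists Psi' : scheme_family L kappa, param_local_LEM Psi';
          exists Psi' : scheme_family L kappa, dual_param_local_IL Psi';
          param_local_LEM Psi;
          dual_param_local_IL Psi])
  /\
  (forall Psi : scheme_family L kappa, simple_local_IL Psi ->
     [<-> semisimple L;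
          exists Psi' : scheme_family L kappa, local_LEM Psi';
          exists Psi' : scheme_family L kappa, dual_local_IL Psi';
          local_LEM Psi;
          dual_local_IL Psi]).
Proof.
have [a apos] := ord_pos_exists hkappa1.
split=> Psi => [sIL|[pf sIL]]; tfae.
- by move=> ss; exists Psi; exact: semisimple_LEM.
- by move=> [Psi' /LEM_dual_IL]; exists Psi'.
(* The passage from an arbitrary [Psi'] to the given [Psi] goes through semisimplicity, which
   mentions no family. *)
- move=> [Psi' dual]; apply: semisimple_LEM => //.
  exact: dual_IL_semisimple hL apos dual.
- exact: LEM_dual_IL.
- exact: dual_IL_semisimple hL apos.
- by move=> ss; exists Psi; split=> //; exact: semisimple_LEM.
- by move=> [Psi' [pf' /LEM_dual_IL]]; exists Psi'; split.
- move=> [Psi' [_ dual]]; split=> //; apply: semisimple_LEM => //.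
  exact: dual_IL_semisimple hL apos dual.
- by move=> [_ /LEM_dual_IL]; split.
- by move=> [_]; exact: dual_IL_semisimple hL apos.
Qed.
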